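(* Let $\Omega\neq\emptyset$ be a set, let $V_n$ be the real linear span of $n$ linearly independent functions $\varphi_1,\ldots,\varphi_n:\Omega\to\mathbb{R}$, and let $L:V_n\to\mathbb{R}$ be a non-trivial ($L\neq0$) $\mathbb{R}$-linear functional. The following assertions are equivalent: (i) $L$ is positively discretizable. (ii) There exists a subset $S\neq\emptyset$ of $\Omega$ such that (a) $L$ is $S$-positive, and (b) the $S$-positive functions in $\ker L$ vanish on $S$. If $L$ is positively discretizable, the maximal number of discretizing nodes needed is $n=\dim_{\mathbb{R}}V_n$ (i.e., $L$ then has a positive discretization with at most $n$ nodes).
   Context: $L$ is called positively discretizable if there exist finitely many nodes $x_1,\ldots,x_N\in\Omega$ and non-negative weights $\lambda_1,\ldots,\lambda_N\ge0$ such that $Lf=\sum_{j=1}^N\lambda_j f(x_j)$ for all $f\in V_n$. For $\emptyset\neq S\subseteq\Omega$, a function $f:\Omega\to\mathbb{R}$ is called $S$-positive if $f(x)\ge0$ for all $x\in S$. The functional $L$ is called $S$-positive if for every $f\in V_n$, $f|_S\ge0$ implies $Lf\ge0$. *)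

(* Defs.v *)
From HB Require Import structures.
From mathcomp Require Import all_boot all_order all_algebra.
From mathcomp Require Import all_classical all_reals.

Set Implicit Arguments.
Unset Strict Implicit.
Unset Printing Implicit Defensive.

Import Order.TTheory GRing.Theory Num.Theory.

Local Open Scope classical_set_scope.
Local Open Scope ring_scope.

Section Span.
Variables (R : realType) (Omega : Type) (n : nat) (phi : 'I_n -> Omega -> R).

(* [free] is only available over a [vectType], which [Omega -> R] is not. *)
Definition linearly_independent : Prop :=
  forall c : 'I_n -> R,
    (forall x, \sum_(i < n) c i * phi i x = 0) -> forall i, c i = 0.

(* The regular module [R^o] makes [Omega -> R^o] an [lmodType R] with the
   pointwise operations. *)
Definition fspan : {pred Omega -> R^o} :=
  [pred f | `[< exists c : 'I_n -> R,
                  forall x, f x = \sum_(i < n) c i * phi i x >]].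

Lemma fspan_submod_closed : submod_closed fspan.
Proof.
split=> [|a f g /asboolP[c fE] /asboolP[d gE]]; apply/asboolP.
  by exists (fun=> 0) => x; rewrite big1// => i _; rewrite mul0r.
exists (fun i => a * c i + d i) => x.
transitivity (a * (f x : R) + (g x : R)) => //.
rewrite fE gE mulr_sumr -big_split/=.
by apply: eq_bigr => i _; rewrite mulrDl mulrA.
Qed.

HB.instance Definition _ :=
  GRing.isSubmodClosed.Build R (Omega -> R^o) fspan fspan_submod_closed.

Record fspan_of : Type := FSpan {
  fspan_fun :> Omega -> R^o;
  _ : fspan_fun \in fspan }.

HB.instance Definition _ := [isSub for fspan_fun].
HB.instance Definition _ := [Choice of fspan_of by <:].
HB.instance Definition _ := [SubChoice_isSubLmodule of fspan_of by <:].

End Span.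

Section Discretization.
Variables (R : realType) (Omega : Type).

Definition fun_positive (S : set Omega) (f : Omega -> R) : Prop :=
  forall x, S x -> 0 <= f x.

Variables (n : nat) (phi : 'I_n -> Omega -> R).
Implicit Type L : {scalar fspan_of phi}.

Definition functional_positive (S : set Omega) L : Prop :=
  forall f : fspan_of phi, fun_positive S f -> 0 <= L f.

Definition has_positive_discretization (N : nat) L : Prop :=
  exists (x : 'I_N -> Omega) (lambda : 'I_N -> R),
    (forall j, 0 <= lambda j) /\
    (forall f : fspan_of phi, L f = \sum_(j < N) lambda j * f (x j)).

Definition positively_discretizable L : Prop :=
  exists N : nat, has_positive_discretization N L.

End Discretization.

(* Main.v *)
Require Import Defs.
From HB Require Import structures.
From mathcomp Require Import all_boot all_order all_algebra.
From mathcomp Require Import all_classical all_reals.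
From mathcomp Require Import ring.

(** A functional [L] on the span of [phi_1 .. phi_n] is determined by the row
    [b = (L phi_1, ..., L phi_n)], and a discretization of [L] with
    non-negative weights and nodes in [S] is the same thing as a way of writing
    [b] as a conic combination of the evaluation rows
    [(phi_1 x, ..., phi_n x)] with [x] in [S]; a linear form on rows is, in
    turn, a function of the span.

    If [L] is discretizable, the nodes carrying a positive weight form a
    suitable [S]: a sum of non-negative terms vanishes only if each term does.
    The bound [n] on the number of nodes is Caratheodory's theorem for cones in
    a space of dimension [n] ([caratheodory_cone]).

    Conversely, let [S] satisfy (a) and (b), and suppose that [b] is not in the
    cone [C] generated by the evaluations on [S]. That cone need not be closed,
    so one cannot separate strictly; but in finite dimension a convex cone and
    a point outside it can always be properly separated
    ([conic_hull_proper_separation]): some function [f] of the span is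
    non-negative on [S], has [L f <= 0], and is not both annihilated by [L] and
    zero on [S]. Now (a) gives [L f = 0] and (b) gives [f = 0] on [S],
    a contradiction.

    Proper separation is proved without topology. Let [e] be the sum of finitely
    many generators that span the same space as [C]; it is an order unit of [C]
    there. As [b] is not in [C], the cone [K] generated by [C] and [- b] does not
    contain [- e]. A maximality argument ([order_unit_functional], a
    finite-dimensional form of the M. Riesz extension theorem) yields a linear
    form that is non-negative on [K] and takes the value [1] at [e]. *)

Set Implicit Arguments.
Unset Strict Implicit.
Unset Printing Implicit Defensive.

Import Order.TTheory GRing.Theory Num.Theory.
Import VectorInternalTheory.

Local Open Scope classical_set_scope.
Local Open Scope ring_scope.

(** * Convex cones and conic hulls *)

Section Cones.
Variables (R : realType) (V : lmodType R).
Implicit Types (A K : set V) (v : V).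

Definition convex_cone K : Prop :=
  [/\ K 0, forall u v, K u -> K v -> K (u + v) &
      forall c v, 0 <= c -> K v -> K (c *: v)].

Definition conic_combination A (N : nat) v : Prop :=
  exists (a : 'I_N -> V) (lambda : 'I_N -> R),
    [/\ forall j, A (a j), forall j, 0 <= lambda j &
        v = \sum_(j < N) lambda j *: a j].

Definition conic_hull A : set V := [set v | exists N, conic_combination A N v].

Lemma convex_cone_sum K (I : eqType) (r : seq I) (F : I -> V) :
  convex_cone K -> (forall i, i \in r -> K (F i)) -> K (\sum_(i <- r) F i).
Proof.
move=> [K0 KD _] KF; rewrite big_seq.
by elim/big_ind: _ => // i; exact: KF.
Qed.

Lemma conic_combinationS A B N v :
  A `<=` B -> conic_combination A N v -> conic_combination B N v.
Proof.
move=> AB [a [l [Aa l0 ->]]].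
by exists a, l; split => // j; apply/AB/Aa.
Qed.

Lemma conic_hull_sub A : A `<=` conic_hull A.
Proof.
move=> a Aa; exists 1%N, (fun=> a), (fun=> 1); split => //.
by rewrite big_ord1 scale1r.
Qed.

Lemma conic_hull_convex_cone A : convex_cone (conic_hull A).
Proof.
split.
- exists 0%N, (fun=> 0), (fun=> 0).
  by split => [[]|//|]; rewrite ?big_ord0.
- move=> _ _ [M [a [l [Aa l0 ->]]]] [N [b [m [Bb m0 ->]]]].
  exists (M + N)%N,
    (fun i : 'I_(M + N) => match fintype.split i with inl j => a j | inr j => b j end),
    (fun i : 'I_(M + N) => match fintype.split i with inl j => l j | inr j => m j end).
  split; [by move=> j; case: fintype.split | by move=> j; case: fintype.split |].
  rewrite big_split_ord/=; congr (_ + _); apply: eq_bigr => j _.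
    by rewrite (unsplitK (inl j)).
  by rewrite (unsplitK (inr j)).
- move=> c _ c0 [N [a [l [Aa l0 ->]]]].
  exists N, a, (fun j => c * l j); split => //.
    by move=> j; rewrite mulr_ge0.
  by rewrite scaler_sumr; apply: eq_bigr => j _; rewrite scalerA.
Qed.

End Cones.

(* Identities between linear combinations are checked on coordinates, where
   they become identities in [R]. *)
Ltac coordinatewise :=
  apply: (can_inj v2rK); apply/rowP => ?;
  rewrite !(linearD, linearN, linearZ, mxE) /=; try ring.

(** * Separation in finite dimension *)

Section Separation.
Variables (R : realType) (V : vectType R).
Implicit Types (A K : set V) (U W : {vspace V}) (b e v : V).

(** Dimension bounds ascending chains of subspaces, so this replaces Zorn's
    lemma for an arbitrary predicate. *)
Lemma vspace_maximal (P : {vspace V} -> Prop) :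
  (exists U, P U) ->
  exists2 U, P U & forall W, P W -> (U <= W)%VS -> (W <= U)%VS.
Proof.
move=> [U0 PU0].
pose Q d := `[< exists2 U, P U & \dim U = d >].
have exQ : exists d, Q d by exists (\dim U0); apply/asboolP; exists U0.
have leQ d : Q d -> (d <= \dim {:V})%N.
  by move=> /asboolP[U _ <-]; exact/dimvS/subvf.
case: (ex_maxnP exQ leQ) => d /asboolP[U PU dU] dmax.
exists U => // W PW UW; rewrite -(geq_leqif (dimv_leqif_sup UW)) dU.
by apply: dmax; apply/asboolP; exists W.
Qed.

(** The residue of the projection on [U] is linear with kernel [U], hence
    nonzero at [e]: [f] is a coordinate of it that does not vanish at [e],
    rescaled. *)
Lemma functional_of_notin U e :
  e \notin U ->
  exists f : {scalar V}, (forall u, u \in U -> f u = 0) /\ f e = 1.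
Proof.
move=> eU.
pose g v : V := v - projv U v.
have gU u : u \in U -> g u = 0 by move=> uU; rewrite /g projv_id ?subrr.
have ge_neq0 : g e != 0.
  by apply: contraNneq eU => /subr0_eq->; exact: memv_proj.
have [i gei] : exists i, v2r (g e) 0 i != 0.
  apply/existsP; apply: contra_neqT ge_neq0; rewrite negb_exists => /forallP g0.
  apply: (can_inj v2rK); rewrite linear0; apply/rowP => i.
  by have /negPn/eqP := g0 i; rewrite mxE.
pose h v : R := v2r (g v) 0 i / v2r (g e) 0 i.
have hlin : scalar h.
  move=> c u v.
  have -> : h (c *: u + v) = (c * v2r (g u) 0 i + v2r (g v) 0 i) / v2r (g e) 0 i.
    rewrite /h; congr (_ / _).
    have -> : g (c *: u + v) = c *: g u + g v.
      by rewrite /g linearP /= scalerBr addrACA opprD.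
    by rewrite linearP !mxE.
  by rewrite mulrDl -mulrA.
pose hL := GRing.isLinear.Build _ _ _ _ h hlin.
pose f : {scalar V} := HB.pack h hL.
exists f; split => [u uU|]; first by rewrite /f/= /h gU// linear0 mxE mul0r.
by rewrite /f/= /h divff.
Qed.

(** Take a subspace [U] maximal among those for which [K + U] avoids [- e].
    The claim is that [U] is a hyperplane complementary to [e]; the linear form
    with kernel [U] and value [1] at [e] is then non-negative on [K], since
    [k = u - t e] with [t > 0] would put [- e] in [K + U]. To reach a given [v],
    let [s] be the supremum of the coefficients with which [e] can be
    subtracted from [v] without leaving [K + U]: adding [v - s e] to [U] still
    avoids [- e], so by maximality [v - s e] is in [U]. *)
Lemma order_unit_functional K e :
  convex_cone K -> (forall v, exists t, K (t *: e + v)) -> ~ K (- e) ->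
  exists f : {scalar V}, (forall v, K v -> 0 <= f v) /\ f e = 1.
Proof.
move=> [K0 KD KZ] Ke KNe.
pose avoids U := forall u, u \in U -> ~ K (- e + u).
have [|U aU Umax] := @vspace_maximal avoids.
  by exists 0%VS => u; rewrite memv0 => /eqP->; rewrite addr0.
have eU : e \notin U by apply/negP => /aU; rewrite addNr.
have noK t u : 0 < t -> u \in U -> ~ K (- t *: e + u).
  move=> t0 uU /(KZ t^-1); rewrite invr_ge0 (ltW t0) => /(_ isT).
  rewrite scalerDr scalerA mulrN mulVf ?gt_eqF// scaleN1r.
  exact/aU/memvZ.
have decomp v : exists s, v - s *: e \in U.
  pose B := [set s | exists2 u, u \in U & K (v - s *: e + u)].
  have B0 : B !=set0.
    have [t Kt] := Ke v; exists (- t), 0; first exact: mem0v.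
    by rewrite scaleNr opprK addr0 addrC.
  have [t Kt] := Ke (- v).
  have Bub : ubound B t.
    move=> s [u uU Ks]; rewrite leNgt; apply/negP => ts.
    apply: (@noK (s - t) u) => //; first by rewrite subr_gt0.
    have := KD _ _ Kt Ks; congr (K _); coordinatewise.
  (* Suppose that [- e + u + c w] is in [K]. Then [c > 0] would let one subtract
     [1 / c] more than the supremum, while for [c < 0] an element of [B] close
     to the supremum would make [K + U] contain a negative multiple of [e]. *)
  pose s0 := sup B; pose w := v - s0 *: e; exists s0.
  have hB : has_sup B by split => //; exists t.
  suff aw : avoids (U + <[w]>)%VS.
    have /subvP := Umax _ aw (addvSl _ _).
    by apply; rewrite (subvP (addvSr _ _))// memv_line.
  move=> _ /memv_addP[u uU [_ /vlineP[c ->] ->]] Kc.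
  have [c0|c0|c0] := ltgtP c 0.
  - have d0 : 0 < - c^-1 by rewrite oppr_gt0 invr_lt0.
    have [s' [u' u'U Ks'] s's0] := sup_adherent d0 hB.
    apply: (@noK (- c^-1 + s' - s0) (- c^-1 *: u + u')).
    + by rewrite subr_gt0 addrC -ltrBlDr.
    + by rewrite rpredD// memvZ.
    + have := KD _ _ (KZ _ _ (ltW d0) Kc) Ks'; congr (K _).
      by rewrite /w; coordinatewise; field; rewrite lt_eqF.
  - have d0 : 0 < c^-1 by rewrite invr_gt0.
    suff /(ub_le_sup (hB.2)) : B (s0 + c^-1) by rewrite gerDl leNgt d0.
    exists (c^-1 *: u); first exact: memvZ.
    have := KZ _ _ (ltW d0) Kc; congr (K _).
    by rewrite /w; coordinatewise; field; rewrite gt_eqF.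
  - by apply: (aU u uU); move: Kc; rewrite c0 scale0r addr0.
have [f [fU fe]] := functional_of_notin eU.
exists f; split=> // k Kk; have [s ksU] := decomp k.
have fk : f k = s.
  have /eqP := fU _ ksU.
  by rewrite linearB linearZ/= fe mulr1 subr_eq0 => /eqP.
rewrite leNgt fk; apply/negP => s0.
apply: (@noK (- s) (k - s *: e)) => //; first by rewrite oppr_gt0.
by rewrite opprK addrC subrK.
Qed.

(** The hull of an infinite [A] need not be closed, so [b] may lie on its
    boundary, where a strict inequality at [b] is impossible. What remains true
    is that the separating hyperplane does not contain everything. *)
Lemma conic_hull_proper_separation A b : ~ conic_hull A b ->
  exists f : {scalar V},
    [/\ forall a, A a -> 0 <= f a, f b <= 0 &
        ~ (f b = 0 /\ forall a, A a -> f a = 0)].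
Proof.
move=> Cb; set C := conic_hull A in Cb.
have [C0 CD CZ] := conic_hull_convex_cone A; rewrite -/C in C0 CD CZ.
pose spanned W := exists2 X : seq V, (forall a, a \in X -> A a) & W = <<X>>%VS.
have [|W [X XA WE] Wmax] := @vspace_maximal spanned.
  by exists <<[::]>>%VS, [::].
have AW a : A a -> a \in W.
  move=> Aa; have sWaX : (W <= <<a :: X>>)%VS.
    by rewrite WE; apply: sub_span => x xX; rewrite inE xX orbT.
  have /Wmax/(_ sWaX)/subvP : spanned <<a :: X>>%VS.
    by exists (a :: X) => // x; rewrite inE => /predU1P[->|/XA].
  by apply; rewrite memv_span// mem_head.
(* Outside the span of [A], a linear form that kills the span is enough. *)
have [bW|bW] := boolP (b \in W); last first.
  have nbW : - b \notin W by rewrite memvN.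
  have [f [fW /eqP]] := functional_of_notin nbW.
  rewrite linearN/= eqr_oppLR => /eqP fb.
  exists f; split=> [a /AW/fW->//||[/eqP + _]]; rewrite fb ?oppr_le0 ?ler01//.
  by rewrite oppr_eq0 oner_eq0.
pose e := \sum_(x <- X) x.
have eW : e \in W by rewrite WE /e big_seq rpred_sum// => x /memv_span.
have Ce v : v \in W -> exists2 t, 0 <= t & C (t *: e + v).
  rewrite WE => vX; pose c i := coord (in_tuple X) i v.
  have vE : v = \sum_(i < size X) c i *: X`_i := coord_span (X := in_tuple X) vX.
  exists (\sum_i `|c i|); first exact: sumr_ge0.
  rewrite vE /e (big_nth 0) big_mkord scaler_sumr -big_split/=.
  apply: convex_cone_sum => // i _; rewrite -scalerDl; apply: CZ.
    rewrite -lerBlDr sub0r (le_trans (ler_norm _))// normrN.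
    by rewrite (bigD1 i)//= lerDl sumr_ge0.
  by apply: conic_hull_sub; apply: XA; rewrite mem_nth.
(* Pulling the cone generated by [C] and [- b] back along the projection on
   [W] gives a cone for which [e] is an order unit of the whole space. *)
pose K : set V := [set v | exists2 t, 0 <= t & C (projv W v + t *: b)].
have [|v||f [fK fe]] := @order_unit_functional K e.
- split.
  + by exists 0 => //; rewrite linear0 scale0r addr0.
  + move=> u v [s s0 Cu] [t t0 Cv]; exists (s + t); first exact: addr_ge0.
    by rewrite linearD scalerDl addrACA; exact: CD.
  + move=> c v c0 [t t0 Cv]; exists (c * t); first exact: mulr_ge0.
    by rewrite linearZ/= -scalerA -scalerDr; exact: CZ.
- have [t t0 Ct] := Ce _ (memv_proj W v).
  exists t, 0 => //.
  by rewrite linearD linearZ/= projv_id// scale0r addr0.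
- move=> [t t0]; rewrite linearN/= projv_id// => Ct.
  move: t0; rewrite le_eqVlt => /predU1P[t0|t0].
    (* A cone containing [- e] along with its order unit [e] is all of [W]. *)
    have [s s0 Cs] := Ce b bW; apply: Cb.
    have := CD _ _ Cs (CZ _ _ s0 Ct); congr (C _).
    by rewrite -t0 scale0r addr0 scalerN addrAC subrr add0r.
  apply: Cb; have [t' t'0 Ct'] := Ce 0 (mem0v W).
  have Ce1 : C e by rewrite /e; apply: convex_cone_sum => // x /XA/conic_hull_sub.
  have := CZ t^-1 _ (ltW _) (CD _ _ Ce1 Ct).
  rewrite addrA subrr add0r scalerA mulVf ?gt_eqF// scale1r; apply.
  by rewrite invr_gt0.
exists f; split.
- move=> a Aa; apply: fK; exists 0 => //.
  by rewrite scale0r addr0 projv_id ?AW//; exact: conic_hull_sub.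
- rewrite -oppr_ge0 -linearN; apply: fK; exists 1 => //.
  by rewrite linearN/= projv_id// scale1r addNr.
- move=> [_ fA]; have := oner_neq0 R; rewrite -fe /e linear_sum big_seq.
  by rewrite big1 ?eqxx// => x /XA/fA.
Qed.

(** Too many vectors satisfy a nontrivial linear relation [k]. Moving the
    weights along [- k] until the first one vanishes keeps the sum and the
    signs, and frees one vector. *)
Lemma conic_combination_drop A N v : (dim V < N)%N ->
  conic_combination A N v -> conic_combination A N.-1 v.
Proof.
case: N => // N VN [a [l [Aa l0 ->]]].
have [k [k0 [i0 ki0]]] : exists k : 'I_N.+1 -> R,
    \sum_i k i *: a i = 0 /\ exists i, 0 < k i.
  have : ~~ free [tuple a i | i < N.+1].
    apply: contraL VN => /eqP; rewrite size_tuple => <-.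
    by rewrite -leqNgt -dimvf dimvS// subvf.
  move=> /freeP/existsNP[k /not_implyP[kE /existsNP[i ki]]].
  have {}kE : \sum_j k j *: a j = 0.
    by rewrite -[RHS]kE; apply: eq_bigr => j _; rewrite nth_mktuple.
  have [ki0|ki0|//] := ltgtP (k i) 0; last by exists k; split => //; exists i.
  exists (fun j => - k j); split; last by exists i; rewrite oppr_gt0.
  by under eq_bigr do rewrite scaleNr; rewrite sumrN kE oppr0.
pose i1 := [arg min_(i < i0 | 0 < k i) (l i / k i)]%O.
have [ki1 i1min] : 0 < k i1 /\ forall j, 0 < k j -> l i1 / k i1 <= l j / k j.
  by rewrite /i1; case: Order.TotalTheory.arg_minP.
pose c := l i1 / k i1; pose l' i := l i - c * k i.
have c0 : 0 <= c by rewrite divr_ge0// ltW.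
have l'0 i : 0 <= l' i.
  rewrite subr_ge0; have [kn|kp] := leP (k i) 0.
    by rewrite (le_trans _ (l0 i))// mulr_ge0_le0.
  by rewrite -ler_pdivlMr// i1min.
exists (a \o lift i1), (l' \o lift i1); split=> [j|j|]; [exact: Aa|exact: l'0|].
transitivity (\sum_i l' i *: a i).
  under [RHS]eq_bigr do rewrite scalerBl -scalerA.
  by rewrite sumrB -scaler_sumr k0 scaler0 subr0.
by rewrite (bigD1_ord i1)//= /l' divfK ?gt_eqF// subrr scale0r add0r.
Qed.

Lemma caratheodory_cone A N v : conic_combination A N v ->
  exists2 M, (M <= dim V)%N & conic_combination A M v.
Proof.
elim: N => [|N IH] Av; first by exists 0%N.
have [VN|NV] := ltnP (dim V) N.+1; last by exists N.+1.
exact/IH/(conic_combination_drop VN Av).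
Qed.

End Separation.

(** * Discretizations as conic combinations of evaluations *)

Section Discretization.
Variables (R : realType) (Omega : Type) (n : nat) (phi : 'I_n -> Omega -> R).
Implicit Types (L : {scalar fspan_of phi}) (f : fspan_of phi).

Definition evaluation (x : Omega) : 'rV[R]_n := \row_i phi i x.

Lemma fspan_of_proof (c : 'I_n -> R) :
  (fun x => \sum_(i < n) c i * phi i x) \in fspan phi.
Proof. by apply/asboolP; exists c. Qed.

Definition linear_combination (c : 'I_n -> R) : fspan_of phi :=
  FSpan (fspan_of_proof c).

(** The values of [L] on the functions [phi i]. *)
Definition functional_row L : 'rV[R]_n :=
  \row_i L (linear_combination (fun j => (j == i)%:R)).

Lemma linear_combination_surj f : exists c, f = linear_combination c.
Proof.
have /asboolP[c fE] := valP f.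
by exists c; apply: val_inj; apply/funext.
Qed.

Lemma linear_combinationE c :
  linear_combination c =
  \sum_(i < n) c i *: linear_combination (fun j => (j == i)%:R).
Proof.
apply: val_inj; rewrite raddf_sum /=; apply/funext => x.
rewrite fct_sumE; apply: eq_bigr => i _.
transitivity (c i * \sum_(j < n) (j == i)%:R * phi j x) => //.
rewrite (bigD1 i)//= eqxx mul1r big1 ?addr0// => j /negPf->.
by rewrite mul0r.
Qed.

Lemma functional_linear_combination L c :
  L (linear_combination c) = \sum_(i < n) c i * functional_row L 0 i.
Proof.
rewrite linear_combinationE linear_sum; apply: eq_bigr => i _.
by rewrite linearZ mxE.
Qed.

Lemma has_positive_discretizationP N L :
  has_positive_discretization N L <->
  conic_combination (range evaluation) N (functional_row L).
Proof.
split=> [[x [l [l0 LE]]]|[a [l [aE l0 LE]]]].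
  exists (evaluation \o x), l; split=> [j|//|]; first by exists (x j).
  apply/rowP => i; rewrite summxE !mxE LE; apply: eq_bigr => j _.
  rewrite !mxE; congr (_ * _) => /=.
  rewrite (bigD1 i)//= eqxx mul1r big1 ?addr0// => k /negPf->.
  by rewrite mul0r.
have /choice[x xE] j : exists x, evaluation x = a j.
  by have [x _ <-] := aE j; exists x.
exists x, l; split=> // f; have [c ->] := linear_combination_surj f.
rewrite functional_linear_combination LE.
under eq_bigr do rewrite summxE mulr_sumr.
rewrite exchange_big; apply: eq_bigr => j _ /=; rewrite mulr_sumr.
by apply: eq_bigr => i _; rewrite -xE !mxE mulrCA.
Qed.

(** Every linear form on rows comes from a function of the span, whose values
    and images under functionals are read off by that form; separating rows is
    therefore the same as finding a function of the span. *)
Lemma functional_rowV (g : {scalar 'rV[R]_n}) :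
  exists f, (forall x, f x = g (evaluation x)) /\
            forall L, L f = g (functional_row L).
Proof.
have gE v : g v = \sum_i g (delta_mx 0 i) * v 0 i.
  rewrite {1}(row_sum_delta v) linear_sum; apply: eq_bigr => i _.
  by rewrite linearZ mulrC.
exists (linear_combination (fun i => g (delta_mx 0 i))); split=> [x|L].
  by rewrite gE; apply: eq_bigr => i _; rewrite mxE.
by rewrite functional_linear_combination gE.
Qed.

(** Nodes of weight zero must be left out of [S]: nothing forces a function in
    the kernel of [L] to vanish there. *)
Lemma discretizable_positivity_set L :
  ~ (forall f, L f = 0) -> positively_discretizable L ->
  exists S : set Omega,
    [/\ S !=set0, functional_positive S L &
        forall f, L f = 0 -> fun_positive S f -> forall x, S x -> f x = 0].
Proof.
move=> L_neq0 [N [x [l [l0 LE]]]].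
exists [set x j | j in [set j | 0 < l j]].
have term_ge0 f (fS : fun_positive [set x j | j in [set j | 0 < l j]] f) j :
    0 <= l j * f (x j).
  have := l0 j; rewrite le_eqVlt => /predU1P[<-|lj]; first by rewrite mul0r.
  by apply: mulr_ge0 => //; apply: fS; exists j.
split.
- apply/set0P; apply: contra_notN L_neq0 => /eqP S0 f.
  rewrite LE big1// => j _.
  have := l0 j; rewrite le_eqVlt => /predU1P[<-|lj]; first by rewrite mul0r.
  have : [set x j | j in [set j | 0 < l j]] (x j) by exists j.
  by rewrite S0.
- by move=> f /term_ge0 fS; rewrite LE; apply: sumr_ge0 => j _; exact: fS.
- move=> f + /term_ge0 fS _ [j /= lj <-]; rewrite LE.
  move=> /(psumr_eq0P (fun i _ => fS i))/(_ j isT)/eqP.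
  by rewrite mulf_eq0 gt_eqF//= => /eqP.
Qed.

Lemma positivity_set_discretizable L (S : set Omega) :
  functional_positive S L ->
  (forall f, L f = 0 -> fun_positive S f -> forall x, S x -> f x = 0) ->
  positively_discretizable L.
Proof.
move=> LS kerS.
suff [N LN] : conic_hull (evaluation @` S) (functional_row L).
  exists N; apply/has_positive_discretizationP; apply: conic_combinationS LN.
  by move=> _ [x _ <-]; exists x.
apply: contrapT => /conic_hull_proper_separation[g [gS gL]]; apply.
have [f [fE LfE]] := functional_rowV g.
have fS : fun_positive S f by move=> x Sx; rewrite fE; apply: gS; exists x.
have Lf0 : L f = 0 by apply/eqP; rewrite eq_le LS// LfE gL.
split=> [|_ [x Sx <-]]; first by rewrite -LfE.
by rewrite -fE; exact: kerS.
Qed.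

Lemma discretization_few_nodes L : positively_discretizable L ->
  exists2 N : nat, (N <= n)%N & has_positive_discretization N L.
Proof.
move=> [N /has_positive_discretizationP/caratheodory_cone[M]].
rewrite dim_matrix mul1r => Mn LM.
by exists M => //; exact/has_positive_discretizationP.
Qed.

End Discretization.

Theorem theorem3p10 (R : realType) (Omega : Type) (n : nat)
    (phi : 'I_n -> Omega -> R) (L : {scalar fspan_of phi})
    (Omega_neq0 : [set: Omega] !=set0)
    (phi_free : linearly_independent phi)
    (L_neq0 : ~ (forall f : fspan_of phi, L f = 0)) :
  (positively_discretizable L <->
    exists S : set Omega,
      [/\ S !=set0,
          functional_positive S L &
          forall f : fspan_of phi, L f = 0 -> fun_positive S f ->
            forall x, S x -> f x = 0]) /\
  (positively_discretizable L ->
    exists2 N : nat, (N <= n)%N & has_positive_discretization N L).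
Proof.
split; last exact: discretization_few_nodes.
split; first exact: discretizable_positivity_set.
by move=> [S [_ LS kerS]]; exact: positivity_set_discretizable LS kerS.
Qed.
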